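(* Let $\mathtt{L}$ be a functional language, $\mathcal{B}$ a weakly $\mathrm{u}_\omega$-compact $\mathtt{L}$-algebra, and $Y$ a non-empty algebraic set over $\mathcal{B}$. Then the following conditions are equivalent: 1) $\mathrm{Th}_{\forall}(\mathcal{B})\subseteq\mathrm{Th}_{\forall}(\Gamma(Y))$, i.e., $\Gamma(Y)\in\mathbf{Ucl}(\mathcal{B})$; 2) $\mathrm{Th}_{\exists}(\mathcal{B})\supseteq\mathrm{Th}_{\exists}(\Gamma(Y))$; 3) $\Gamma(Y)$ embeds into an ultrapower of $\mathcal{B}$; 4) $\Gamma(Y)$ is discriminated by $\mathcal{B}$; 5) $\Gamma(Y)$ is a limit algebra over $\mathcal{B}$; 6) $\Gamma(Y)$ is an algebra defined by a complete atomic type in the theory $\mathrm{Th}_{\forall}(\mathcal{B})$ in $\mathtt{L}$; 7) $Y$ is irreducible. Moreover, if $\mathcal{B}$ is an $\mathtt{L}$-algebra such that for every non-empty algebraic set $Y$ over $\mathcal{B}$ the conditions 1)--7) are equivalent, then $\mathcal{B}$ is weakly $\mathrm{u}_\omega$-compact.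
   Context: A functional language $\mathtt{L}$ is a first-order language with function and constant symbols only (and equality); $\mathtt{L}$-structures are called $\mathtt{L}$-algebras. For a finite set of variables $X=\{x_1,\dots,x_n\}$, $\mathcal{T}_{\mathtt{L}}(X)$ is the absolutely free algebra of terms, and $\mathrm{At}_{\mathtt{L}}(X)$ is the set of atomic formulas $(t=s)$ in variables $X$ (equations). A system of equations is a subset $S\subseteq \mathrm{At}_{\mathtt{L}}(X)$; $\mathrm{V}_{\mathcal{B}}(S)\subseteq B^n$ is its solution set in $\mathcal{B}$; sets of this form are the algebraic sets over $\mathcal{B}$. An algebraic set is irreducible if it is non-empty and is not a finite union of proper algebraic subsets. The radical $\mathrm{Rad}(Y)$ of an algebraic set $Y=\mathrm{V}_{\mathcal{B}}(S)$ is the largest system of equations in $\mathrm{At}_{\mathtt{L}}(X)$ with solution set $Y$, i.e. the set of all $(t=s)\in\mathrm{At}_{\mathtt{L}}(X)$ holding at all points of $Y$; it defines a congruence $\theta_{\mathrm{Rad}(Y)}$ on $\mathcal{T}_{\mathtt{L}}(X)$ ($t_1\sim t_2$ iff $(t_1=t_2)\in\mathrm{Rad}(Y)$), and $\Gamma(Y)=\mathcal{T}_{\mathtt{L}}(X)/\theta_{\mathrm{Rad}(Y)}$ is the coordinate algebra of $Y$. $\mathrm{Th}_\forall(\mathcal{B})$ and $\mathrm{Th}_\exists(\mathcal{B})$ are the sets of universal, respectively existential, sentences of $\mathtt{L}$ true in $\mathcal{B}$; $\mathbf{Ucl}(\mathcal{B})$ is the class of all models of $\mathrm{Th}_\forall(\mathcal{B})$.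 $\mathcal{B}$ is weakly $\mathrm{u}_\omega$-compact if every non-empty algebraic set $Y$ over $\mathcal{B}$ whose coordinate algebra $\Gamma(Y)$ belongs to $\mathbf{Ucl}(\mathcal{B})$ is irreducible. $\mathcal{C}$ is discriminated by $\mathcal{B}$ if for any finite $W\subseteq C$ there is a homomorphism $h\colon\mathcal{C}\to\mathcal{B}$ injective on $W$; by convention the trivial (one-element) algebra $\mathcal{E}$ is discriminated by $\mathcal{B}$ iff $\mathcal{B}$ has a trivial subalgebra. Limit algebras. For a finite functional language $\mathtt{L}_0$ and a finite non-empty set of variables $Z$, a diagram-formula in $\mathtt{L}_0$ in variables $Z$ is a conjunction $\varphi$ of formulas of the forms $F(y_1,\dots,y_k)=y_0$, $c=y_0$, $y=y'$ ($F,c\in\mathtt{L}_0$, variables in $Z$) and their negations such that: $\neg(y=y')$ occurs in $\varphi$ for all distinct $y,y'\in Z$; for each function symbol $F\in\mathtt{L}_0$ and all $y_0,\dots,y_k\in Z$ either $F(y_1,\dots,y_k)=y_0$ or its negation occurs in $\varphi$; for each constant $c\in\mathtt{L}_0$ and $y\in Z$ either $c=y$ or its negation occurs in $\varphi$. A direct system of formulas in $\mathtt{L}$ is a triple $\Lambda=(I,\varphi_i,\gamma_{ij})$ where $I$ is a directed partial order; for each $i\in I$, $\varphi_i$ is a consistent diagram-formula in a finite sublanguage $\mathtt{L}_i\subseteq\mathtt{L}$ in variables $X_i$; for $i\le j$, $\gamma_{ij}\colon X_i\to X_j$ are maps with $\gamma_{ii}=\mathrm{id}$ and $\gamma_{jk}\gamma_{ij}=\gamma_{ik}$;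 for $i\le j$, $\mathtt{L}_i\subseteq\mathtt{L}_j$ and every conjunct of $\varphi_i(\gamma_{ij}(X_i))$ is a conjunct of $\varphi_j$; for each constant $c\in\mathtt{L}$ there are $i\in I$, $x\in X_i$ such that $c=x$ is a conjunct of $\varphi_i$; for each function symbol $F\in\mathtt{L}$ of arity $k$, $i\in I$ and $y_1,\dots,y_k\in X_i$ there are $j\ge i$ and $y_0\in X_j$ such that $F(\gamma_{ij}(y_1),\dots,\gamma_{ij}(y_k))=y_0$ is a conjunct of $\varphi_j$. The limit algebra of $\Lambda$ has as universe the direct limit of the sets $X_i$ along the maps $\gamma_{ij}$, with constants and operations determined by the conjuncts $c=x$ and $F(y_1,\dots,y_k)=y_0$ of the $\varphi_i$. An $\mathtt{L}$-algebra is a limit algebra over $\mathcal{B}$ if it is isomorphic to the limit algebra of a direct system of formulas in which every $\varphi_i$ is satisfiable in $\mathcal{B}$. Complete atomic types. For a theory $T$ in $\mathtt{L}$ and a finite set $X$, an atomic type in $T$ in variables $X$ is a set $p$ of atomic formulas and negations of atomic formulas in variables $X$ such that $p\cup T$ is consistent (satisfiable, with the variables $X$ interpreted by elements of a model of $T$); it is complete if it is maximal under inclusion. The algebra defined by a complete atomic type $p$ is $\mathcal{T}_{\mathtt{L}}(X)/\theta_{p}$, where $t_1\sim_{\theta_p}t_2$ iff $(t_1=t_2)\in p$ (up to isomorphism). *)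

(* Defs.v *)
From Stdlib Require Export RelationClasses.
From mathcomp Require Export all_boot.
From mathcomp Require Export boolp classical_sets functions cardinality filter.

Set Implicit Arguments.
Unset Strict Implicit.
Unset Printing Implicit Defensive.

Local Open Scope classical_set_scope.

Definition class_of (T : Type) (R : T -> T -> Prop) (x : T) : set T :=
  [set y | R x y].

Definition quotient (T : Type) (R : T -> T -> Prop) : Type :=
  {C : set T | exists x, C = class_of R x}.

Definition pi (T : Type) (R : T -> T -> Prop) (x : T) : quotient R :=
  exist _ (class_of R x) (ex_intro _ x erefl).

Definition repr (T : Type) (R : T -> T -> Prop) (c : quotient R) : T :=
  projT1 (cid (proj2_sig c)).

Lemma reprK (T : Type) (R : T -> T -> Prop) (c : quotient R) :
  pi R (repr c) = c.
Proof.
rewrite /repr; case: (cid _) => x /= cx; case: c cx => C /= hC cx.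
by apply: eq_exist; rewrite cx.
Qed.

Lemma pi_eq (T : Type) (R : T -> T -> Prop) :
  Equivalence R -> forall x y, pi R x = pi R y <-> R x y.
Proof.
move=> [Rr Rs Rt] x y; split.
  move=> /(congr1 (@proj1_sig _ _)) /= e.
  have : class_of R y y by exact: Rr.
  by rewrite -e.
move=> xy; apply: eq_exist; apply/seteqP; split=> z /= Rz.
  exact: Rt (Rs _ _ xy) Rz.
exact: Rt xy Rz.
Qed.

Record language := Language {
  fsym : Type;
  csym : Type;
  arity : fsym -> nat;
  arity_gt0 : forall F, 0 < arity F }.

Record algebra (L : language) := Algebra {
  carrier :> Type;
  carrier_inh : inhabited carrier;
  fun_op : forall F : fsym L, ('I_(arity F) -> carrier) -> carrier;
  cst_op : csym L -> carrier }.
Arguments fun_op {L} _ _ _.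
Arguments cst_op {L} _ _.

Definition is_hom (L : language) (A B : algebra L) (h : A -> B) : Prop :=
  (forall F (u : 'I_(arity F) -> A), h (fun_op A F u) = fun_op B F (h \o u))
  /\ (forall c, h (cst_op A c) = cst_op B c).

(* There being no relation symbols, an embedding is an injective
   homomorphism. *)
Definition embeds (L : language) (A B : algebra L) : Prop :=
  exists2 h : A -> B, is_hom h & injective h.

Definition isomorphic (L : language) (A B : algebra L) : Prop :=
  exists2 h : A -> B, is_hom h & bijective h.

Inductive term (L : language) (X : Type) : Type :=
  | Var of X
  | App (F : fsym L) of 'I_(arity F) -> term L X
  | Cst of csym L.
Arguments Var {L X} _.
Arguments App {L X} _ _.
Arguments Cst {L X} _.

Fixpoint eval (L : language) (A : algebra L) (X : Type) (v : X -> A)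
    (t : term L X) : A :=
  match t with
  | Var x => v x
  | App F ts => fun_op A F (fun k => eval v (ts k))
  | Cst c => cst_op A c
  end.

(* The terms form an algebra only if there are any: [X] is non-empty or [L] has
   a constant symbol. *)
Definition term_algebra (L : language) (X : Type)
    (TX : inhabited (term L X)) : algebra L :=
  Algebra TX (@App L X) (@Cst L X).

Record congruence (L : language) (A : algebra L) := Congruence {
  cong_rel :> A -> A -> Prop;
  cong_equiv : Equivalence cong_rel;
  cong_fun : forall F (u v : 'I_(arity F) -> A),
    (forall k, cong_rel (u k) (v k)) ->
    cong_rel (fun_op A F u) (fun_op A F v) }.

Lemma quotient_inh (L : language) (A : algebra L) (R : A -> A -> Prop) :
  inhabited (quotient R).
Proof. by have [a] := carrier_inh A; constructor; exact: pi R a. Qed.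

Definition quotient_algebra (L : language) (A : algebra L)
    (theta : congruence A) : algebra L :=
  Algebra (quotient_inh theta)
    (fun F u => pi theta (fun_op A F (fun k => repr (u k))))
    (fun c => pi theta (cst_op A c)).

Lemma pi_is_hom (L : language) (A : algebra L) (theta : congruence A) :
  is_hom (A := A) (B := quotient_algebra theta) (pi theta).
Proof.
split=> // F u /=; apply/pi_eq; first exact: cong_equiv.
by apply: cong_fun => k; apply/(pi_eq (cong_equiv theta)); rewrite reprK.
Qed.

(* [formula L n] are the formulas whose free variables are among [n]
   variables; a quantifier binds the variable [ord0] of its body. *)

Inductive formula (L : language) : nat -> Type :=
  | FEq n of term L 'I_n & term L 'I_n : formula L n
  | FNot n of formula L n : formula L n
  | FAnd n of formula L n & formula L n : formula L n
  | FOr n of formula L n & formula L n : formula L n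
  | FAll n of formula L n.+1 : formula L n
  | FEx n of formula L n.+1 : formula L n.

Definition env_cons (A : Type) (n : nat) (a : A) (v : 'I_n -> A)
    (i : 'I_n.+1) : A :=
  if unlift ord0 i is Some j then v j else a.

Fixpoint sat (L : language) (A : algebra L) (n : nat) (f : formula L n) :
    ('I_n -> A) -> Prop :=
  match f in formula _ n return ('I_n -> A) -> Prop with
  | FEq _ t s => fun v => eval v t = eval v s
  | FNot _ g => fun v => ~ sat g v
  | FAnd _ g h => fun v => sat g v /\ sat h v
  | FOr _ g h => fun v => sat g v \/ sat h v
  | FAll _ g => fun v => forall a, sat g (env_cons a v)
  | FEx _ g => fun v => exists a, sat g (env_cons a v)
  end.

Fixpoint qfree (L : language) (n : nat) (f : formula L n) : Prop :=
  match f with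
  | FEq _ _ _ => True
  | FNot _ g => qfree g
  | FAnd _ g h | FOr _ g h => qfree g /\ qfree h
  | FAll _ _ | FEx _ _ => False
  end.

Definition sentence (L : language) : Type := formula L 0.

Definition holds_in (L : language) (A : algebra L) (s : sentence L) : Prop :=
  forall v : 'I_0 -> A, sat s v.

Fixpoint forall_closure (L : language) (n : nat) :
    formula L n -> sentence L :=
  match n with
  | 0 => id
  | m.+1 => fun f => forall_closure (FAll f)
  end.

Fixpoint exists_closure (L : language) (n : nat) :
    formula L n -> sentence L :=
  match n with
  | 0 => id
  | m.+1 => fun f => exists_closure (FEx f)
  end.

Definition universal (L : language) (s : sentence L) : Prop :=
  exists n (f : formula L n), qfree f /\ s = forall_closure f.

Definition existential (L : language) (s : sentence L) : Prop :=
  exists n (f : formula L n), qfree f /\ s = exists_closure f.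

Definition theory (L : language) : Type := set (sentence L).

Definition models (L : language) (A : algebra L) (T : theory L) : Prop :=
  forall s, T s -> holds_in A s.

Definition Th_forall (L : language) (A : algebra L) : theory L :=
  [set s | universal s /\ holds_in A s].

Definition Th_exists (L : language) (A : algebra L) : theory L :=
  [set s | existential s /\ holds_in A s].

Definition Ucl (L : language) (B A : algebra L) : Prop :=
  models A (Th_forall B).

Definition equation (L : language) (n : nat) : Type :=
  (term L 'I_n * term L 'I_n)%type.

Definition eq_holds (L : language) (A : algebra L) (n : nat) (v : 'I_n -> A)
    (e : equation L n) : Prop :=
  eval v e.1 = eval v e.2.

Definition solutions (L : language) (B : algebra L) (n : nat)
    (S : set (equation L n)) : set ('I_n -> B) :=
  [set v | forall e, S e -> eq_holds v e].
Arguments solutions {L} B {n} S _.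

Definition algebraic (L : language) (B : algebra L) (n : nat)
    (Y : set ('I_n -> B)) : Prop :=
  exists S : set (equation L n), Y = solutions B S.

Definition irreducible (L : language) (B : algebra L) (n : nat)
    (Y : set ('I_n -> B)) : Prop :=
  Y !=set0 /\
  ~ exists m (Z : 'I_m -> set ('I_n -> B)),
      (forall i, algebraic (Z i) /\ Z i `<` Y) /\ Y = \bigcup_i Z i.

Definition Rad (L : language) (B : algebra L) (n : nat)
    (Y : set ('I_n -> B)) : set (equation L n) :=
  [set e | forall v, Y v -> eq_holds v e].

Section Coordinate.
Variables (L : language) (B : algebra L) (n : nat).
Variables (TX : inhabited (term L 'I_n)) (Y : set ('I_n -> B)).

Definition Rad_rel (t s : term_algebra TX) : Prop := Rad Y (t, s).

Lemma Rad_rel_equiv : Equivalence Rad_rel.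
Proof.
split=> [t v _ //|t s ts v Yv|t s r ts sr v Yv].
  by apply/esym; exact: ts.
by apply: etrans (ts v Yv) _; exact: sr.
Qed.

Lemma Rad_rel_fun F (u w : 'I_(arity F) -> term_algebra TX) :
  (forall k, Rad_rel (u k) (w k)) ->
  Rad_rel (fun_op (term_algebra TX) F u) (fun_op (term_algebra TX) F w).
Proof.
move=> uw v Yv; rewrite /eq_holds /=; congr (fun_op B F _).
by apply/funext => k; exact: uw.
Qed.

Definition Rad_congruence : congruence (term_algebra TX) :=
  Congruence Rad_rel_equiv Rad_rel_fun.

Definition coordinate_algebra : algebra L := quotient_algebra Rad_congruence.

End Coordinate.

Definition weakly_u_omega_compact (L : language) (B : algebra L) : Prop :=
  forall (n : nat) (TX : inhabited (term L 'I_n)) (Y : set ('I_n -> B)),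
    algebraic Y -> Y !=set0 -> Ucl B (coordinate_algebra TX Y) ->
    irreducible Y.

(* For [C] trivial this says that there is a homomorphism from [C] to [B], i.e.
   that [B] has a trivial subalgebra. *)
Definition discriminated (L : language) (C B : algebra L) : Prop :=
  forall W : set C, finite_set W -> exists2 h : C -> B, is_hom h & set_inj W h.

Section Ultrapower.
Variables (L : language) (B : algebra L) (I : Type).

Lemma power_inh : inhabited (I -> B).
Proof. by have [b] := carrier_inh B; constructor; exact: (fun=> b). Qed.

Definition power_algebra : algebra L :=
  Algebra power_inh
    (fun F u => fun i => fun_op B F (fun k => u k i))
    (fun c => fun=> cst_op B c).

Variables (D : set_system I) (UD : UltraFilter D).

Definition ultra_rel (f g : power_algebra) : Prop := D [set i | f i = g i].

Lemma ultra_rel_equiv : Equivalence ultra_rel.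
Proof.
split=> [f|f g|f g h]; rewrite /ultra_rel.
- by apply: filterS filterT.
- by apply: filterS => i /= ->.
- by apply: filterS2 => i /= -> ->.
Qed.

Lemma ultra_rel_fun F (u w : 'I_(arity F) -> power_algebra) :
  (forall k, ultra_rel (u k) (w k)) ->
  ultra_rel (fun_op power_algebra F u) (fun_op power_algebra F w).
Proof.
move=> /filter_forall; apply: filterS => i /= uw.
by congr (fun_op B F _); apply/funext.
Qed.

Definition ultra_congruence : congruence power_algebra :=
  Congruence ultra_rel_equiv ultra_rel_fun.

Definition ultrapower : algebra L := quotient_algebra ultra_congruence.

End Ultrapower.

Inductive literal (A : Type) : Type := Pos of A | Neg of A.

Definition lit_holds (A : Type) (P : A -> Prop) (l : literal A) : Prop :=
  match l with Pos a => P a | Neg a => ~ P a end.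

Definition lit_atom (A : Type) (l : literal A) : A :=
  match l with Pos a | Neg a => a end.

Definition lit_map (A B : Type) (f : A -> B) (l : literal A) : literal B :=
  match l with Pos a => Pos (f a) | Neg a => Neg (f a) end.

Definition atomic_type (L : language) (T : theory L) (n : nat)
    (p : set (literal (equation L n))) : Prop :=
  exists2 A : algebra L, models A T &
    exists v : 'I_n -> A, forall l, p l -> lit_holds (eq_holds v) l.

Definition complete_atomic_type (L : language) (T : theory L) (n : nat)
    (p : set (literal (equation L n))) : Prop :=
  atomic_type T p /\ forall q, atomic_type T q -> p `<=` q -> q = p.

Lemma complete_atomic_typeE (L : language) (T : theory L) (n : nat)
    (p : set (literal (equation L n))) :
  complete_atomic_type T p ->
  exists A : algebra L, exists v : 'I_n -> A,
    models A T /\ p = [set l | lit_holds (eq_holds v) l].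
Proof.
move=> [[A AT [v pv]] pmax]; exists A, v; split=> //.
by apply/esym/pmax => //; exists A => //; exists v.
Qed.

Section TypeAlgebra.
Variables (L : language) (n : nat) (TX : inhabited (term L 'I_n)).
Variables (T : theory L) (p : set (literal (equation L n))).
Hypothesis pT : complete_atomic_type T p.

Definition type_rel (t s : term_algebra TX) : Prop := p (Pos (t, s)).

Lemma type_rel_equiv : Equivalence type_rel.
Proof.
have [A [v [_ e]]] := complete_atomic_typeE pT.
split=> [t|t s|t s r]; rewrite /type_rel e //= /eq_holds /=.
by move=> -> ->.
Qed.

Lemma type_rel_fun F (u w : 'I_(arity F) -> term_algebra TX) :
  (forall k, type_rel (u k) (w k)) ->
  type_rel (fun_op (term_algebra TX) F u) (fun_op (term_algebra TX) F w).
Proof.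
have [A [v [_ e]]] := complete_atomic_typeE pT.
rewrite /type_rel e => uw; rewrite /= /eq_holds /=; congr (fun_op A F _).
by apply/funext => k; exact: uw.
Qed.

Definition type_congruence : congruence (term_algebra TX) :=
  Congruence type_rel_equiv type_rel_fun.

Definition type_algebra : algebra L := quotient_algebra type_congruence.

End TypeAlgebra.

Definition defined_by_complete_atomic_type (L : language) (T : theory L)
    (A : algebra L) : Prop :=
  exists n (TX : inhabited (term L 'I_n)) (p : set (literal (equation L n)))
    (pT : complete_atomic_type T p),
    isomorphic A (type_algebra TX pT).

Record finite_sublanguage (L : language) := FiniteSublanguage {
  sub_fsym : set (fsym L);
  sub_csym : set (csym L);
  sub_fsym_finite : finite_set sub_fsym;
  sub_csym_finite : finite_set sub_csym }.

Definition sublanguage_le (L : language) (L0 L1 : finite_sublanguage L) : Prop :=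
  sub_fsym L0 `<=` sub_fsym L1 /\ sub_csym L0 `<=` sub_csym L1.

(* [DFun F y y0], [DCst c y0] and [DEq y y'] stand for [F(y) = y0], [c = y0] and
   [y = y']. *)
Inductive diagram_atom (L : language) (Z : Type) : Type :=
  | DFun (F : fsym L) of 'I_(arity F) -> Z & Z
  | DCst of csym L & Z
  | DEq of Z & Z.
Arguments DFun {L Z} _ _ _.
Arguments DCst {L Z} _ _.
Arguments DEq {L Z} _ _.

Definition atom_in (L : language) (L0 : finite_sublanguage L) (Z : Type)
    (a : diagram_atom L Z) : Prop :=
  match a with
  | DFun F _ _ => sub_fsym L0 F
  | DCst c _ => sub_csym L0 c
  | DEq _ _ => True
  end.

Definition atom_holds (L : language) (A : algebra L) (Z : Type) (v : Z -> A)
    (a : diagram_atom L Z) : Prop :=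
  match a with
  | DFun F y y0 => fun_op A F (v \o y) = v y0
  | DCst c y0 => cst_op A c = v y0
  | DEq y y' => v y = v y'
  end.

Definition atom_map (L : language) (Z Z' : Type) (g : Z -> Z')
    (a : diagram_atom L Z) : diagram_atom L Z' :=
  match a with
  | DFun F y y0 => DFun F (g \o y) (g y0)
  | DCst c y0 => DCst c (g y0)
  | DEq y y' => DEq (g y) (g y')
  end.

(* A conjunction is given by the set of its conjuncts. This set is finite for a
   diagram-formula, as there are only finitely many literals in [L0] and [Z]. *)
Definition conjunction (L : language) (Z : Type) : Type :=
  set (literal (diagram_atom L Z)).

Definition diagram_formula (L : language) (L0 : finite_sublanguage L)
    (Z : finType) (phi : conjunction L Z) : Prop :=
  [/\ forall l, phi l -> atom_in L0 (lit_atom l),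
      forall y y' : Z, y <> y' -> phi (Neg (DEq y y')),
      forall F (y : 'I_(arity F) -> Z) (y0 : Z), sub_fsym L0 F ->
        phi (Pos (DFun F y y0)) \/ phi (Neg (DFun F y y0))
    & forall c (y : Z), sub_csym L0 c ->
        phi (Pos (DCst c y)) \/ phi (Neg (DCst c y))].

Definition satisfiable_in (L : language) (A : algebra L) (Z : Type)
    (phi : conjunction L Z) : Prop :=
  exists v : Z -> A, forall l, phi l -> lit_holds (atom_holds v) l.

Definition consistent (L : language) (Z : Type) (phi : conjunction L Z) : Prop :=
  exists A : algebra L, satisfiable_in A phi.

(* The value of [ds_gamma i j] matters only when [ds_le i j]. *)
Record direct_system (L : language) := DirectSystem {
  ds_index : Type;
  ds_le : ds_index -> ds_index -> Prop;
  ds_le_refl : forall i, ds_le i i;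
  ds_le_anti : forall i j, ds_le i j -> ds_le j i -> i = j;
  ds_le_trans : forall i j k, ds_le i j -> ds_le j k -> ds_le i k;
  ds_inh : inhabited ds_index;
  ds_directed : forall i j, exists k, ds_le i k /\ ds_le j k;
  ds_lang : ds_index -> finite_sublanguage L;
  ds_var : ds_index -> finType;
  ds_var_gt0 : forall i, 0 < #|ds_var i|;
  ds_phi : forall i, conjunction L (ds_var i);
  ds_phi_diagram : forall i, diagram_formula (ds_lang i) (@ds_phi i);
  ds_phi_consistent : forall i, consistent (@ds_phi i);
  ds_gamma : forall i j, ds_var i -> ds_var j;
  ds_gamma_id : forall i x, @ds_gamma i i x = x;
  ds_gamma_comp : forall i j k x, ds_le i j -> ds_le j k ->
    @ds_gamma j k (@ds_gamma i j x) = @ds_gamma i k x;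
  ds_lang_le : forall i j, ds_le i j -> sublanguage_le (ds_lang i) (ds_lang j);
  ds_phi_le : forall i j l, ds_le i j -> @ds_phi i l ->
    @ds_phi j (lit_map (atom_map (@ds_gamma i j)) l);
  ds_cst : forall c, exists i (x : ds_var i), @ds_phi i (Pos (DCst c x));
  ds_fun : forall F i (y : 'I_(arity F) -> ds_var i),
    exists j (y0 : ds_var j), ds_le i j /\
      @ds_phi j (Pos (DFun F (fun k => @ds_gamma i j (y k)) y0)) }.
Arguments ds_phi {L} d i _.
Arguments ds_gamma {L} d i j _.

Section LimitAlgebra.
Variables (L : language) (S : direct_system L).

Definition limit_rel (p q : {i : ds_index S & ds_var i}) : Prop :=
  exists k, [/\ ds_le (projT1 p) k, ds_le (projT1 q) k &
    ds_gamma S _ k (projT2 p) = ds_gamma S _ k (projT2 q)].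

Lemma limit_rel_equiv : Equivalence limit_rel.
Proof.
split.
- by move=> [i x]; exists i; split=> //; exact: ds_le_refl.
- by move=> p q [k [pk qk e]]; exists k.
- move=> [i x] [j y] [l z] [k [/= ik jk e]] [m [/= jm lm e']].
  have [n [kn mn]] := ds_directed k m; exists n.
  split=> /=; [exact: ds_le_trans ik kn|exact: ds_le_trans lm mn|].
  rewrite -(ds_gamma_comp x ik kn) e (ds_gamma_comp y jk kn).
  by rewrite -(ds_gamma_comp y jm mn) e' (ds_gamma_comp z lm mn).
Qed.

Definition limit_set : Type := quotient limit_rel.

Definition limit_in (i : ds_index S) (x : ds_var i) : limit_set :=
  pi limit_rel (existT _ i x).

Lemma limit_in_gamma i j (x : ds_var i) :
  ds_le i j -> limit_in (ds_gamma S i j x) = limit_in x.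
Proof.
move=> ij; apply/(pi_eq limit_rel_equiv); exists j; split=> //=.
  exact: ds_le_refl.
by rewrite ds_gamma_id.
Qed.

Lemma limit_inh : inhabited limit_set.
Proof.
have [i] := ds_inh S; have /card_gt0P [x _] := ds_var_gt0 i.
by constructor; exact: limit_in x.
Qed.

Definition limit_cst_graph (c : csym L) (w : limit_set) : Prop :=
  exists i (x : ds_var i), ds_phi S i (Pos (DCst c x)) /\ w = limit_in x.

Definition limit_fun_graph (F : fsym L) (u : 'I_(arity F) -> limit_set)
    (w : limit_set) : Prop :=
  exists i (y : 'I_(arity F) -> ds_var i) (y0 : ds_var i),
    [/\ ds_phi S i (Pos (DFun F y y0)), u = (fun k => limit_in (y k))
      & w = limit_in y0].

Lemma limit_cst_total c : exists w, limit_cst_graph c w.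
Proof. by have [i [x cx]] := ds_cst S c; exists (limit_in x), i, x. Qed.

Lemma directed_family n (f : 'I_n -> ds_index S) :
  exists j, forall k, ds_le (f k) j.
Proof.
elim: n f => [|n IHn] f; first by have [j] := ds_inh S; exists j; case.
have [j fj] := IHn (fun k => f (lift ord0 k)).
have [m [fm jm]] := ds_directed (f ord0) j.
exists m => k; case: (unliftP ord0 k) => [l ->|-> //].
exact: ds_le_trans (fj l) jm.
Qed.

Lemma limit_fun_total F u : exists w, @limit_fun_graph F u w.
Proof.
have [i ui] := directed_family (fun k => projT1 (repr (u k))).
have [j [y0 [ij Fy]]] :=
  ds_fun (fun k => ds_gamma S _ i (projT2 (repr (u k)))).
exists (limit_in y0), j.
exists (fun k => ds_gamma S i j (ds_gamma S _ i (projT2 (repr (u k))))), y0.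
split; [exact: Fy| |by []].
apply/funext => k; rewrite limit_in_gamma // limit_in_gamma //.
by rewrite -[LHS]reprK /limit_in; case: (repr _).
Qed.

Definition limit_algebra : algebra L :=
  Algebra limit_inh
    (fun F u => projT1 (cid (limit_fun_total u)))
    (fun c => projT1 (cid (limit_cst_total c))).

(* The conjuncts determine the operations and constants, so the choices made
   in [limit_algebra] are immaterial. *)
Lemma limit_cstE i c (x : ds_var i) :
  ds_phi S i (Pos (DCst c x)) -> cst_op limit_algebra c = limit_in x.
Proof.
move=> cx /=; case: cid => _ /= [j [y [cy ->]]].
have [k [ik jk]] := ds_directed i j.
rewrite -(limit_in_gamma x ik) -(limit_in_gamma y jk); congr limit_in.
have [A [v hv]] := ds_phi_consistent k.
apply: contrapT => ne; have [_ /(_ _ _ ne) nexy _ _] := ds_phi_diagram k.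
move: (hv _ nexy) (hv _ (ds_phi_le ik cx)) (hv _ (ds_phi_le jk cy)) => /=.
by move=> nxy ex ey; apply: nxy; rewrite -ex -ey.
Qed.

Lemma limit_funE i F (y : 'I_(arity F) -> ds_var i) (y0 : ds_var i) :
  ds_phi S i (Pos (DFun F y y0)) ->
  fun_op limit_algebra F (fun k => limit_in (y k)) = limit_in y0.
Proof.
move=> Fy /=; case: cid => _ /= [j [z [z0 [Fz yz ->]]]].
have yz' k : exists m, [/\ ds_le i m, ds_le j m &
    ds_gamma S i m (y k) = ds_gamma S j m (z k)].
  by have /(congr1 (fun f => f k)) /(pi_eq limit_rel_equiv) := yz.
have [f fP] := boolp.choice yz'.
have [m fm] := directed_family f.
have [n [im jn]] := ds_directed i j.
have [l [ml nl]] := ds_directed m n.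
have il : ds_le i l by exact: ds_le_trans im nl.
have jl : ds_le j l by exact: ds_le_trans jn nl.
have eyz : ds_gamma S i l \o y = ds_gamma S j l \o z.
  apply/funext => k /=; have [ik jk e] := fP k.
  have fl : ds_le (f k) l by exact: ds_le_trans (fm k) ml.
  by rewrite -(ds_gamma_comp (y k) ik fl) e (ds_gamma_comp (z k) jk fl).
rewrite -(limit_in_gamma y0 il) -(limit_in_gamma z0 jl); congr limit_in.
have [A [v hv]] := ds_phi_consistent l.
apply: contrapT => ne; have [_ /(_ _ _ ne) nexy _ _] := ds_phi_diagram l.
move: (hv _ nexy) (hv _ (ds_phi_le il Fy)) (hv _ (ds_phi_le jl Fz)) => /=.
by rewrite eyz => nyz ey ez; apply: nyz; rewrite -ey -ez.
Qed.

End LimitAlgebra.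

Definition limit_algebra_over (L : language) (B A : algebra L) : Prop :=
  exists S : direct_system L,
    (forall i : ds_index S, satisfiable_in B (ds_phi S i)) /\
    isomorphic A (limit_algebra S).

(* Main.v *)
(* Every condition except 4) and 7) is equivalent to [Gamma(Y)] being in
   [Ucl(B)] for any [B]; weak compactness only supplies the passage from
   [Ucl(B)] to irreducibility. If [Y] is irreducible, a point of [Y] outside
   finitely many proper algebraic subsets of [Y] is a homomorphism
   [Gamma(Y) -> B] separating prescribed elements, which is 4); applied to the
   finite subsets of [Gamma(Y)] and their diagrams, 4) gives 5). A limit algebra
   over [B] is in [Ucl(B)] because the value of a quantifier-free formula is
   determined by one of the diagrams, and each diagram is realized in [B]. For
   6) the type is that of the generic point of [Gamma(Y)], and for 3) the
   ultrafilter lives on [B^n]. *)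

Require Import Defs.
From mathcomp Require Import finmap.

Set Implicit Arguments.
Unset Strict Implicit.
Unset Printing Implicit Defensive.

Local Open Scope classical_set_scope.

(** * Universal classes *)

Section Closures.
Variables (L : language) (A : algebra L).

Lemma env_cons_eta n (v : 'I_n.+1 -> A) :
  env_cons (v ord0) (v \o lift ord0) = v.
Proof.
by apply/funext => i; rewrite /env_cons; case: (unliftP ord0 i) => [j|] ->.
Qed.

Lemma holds_forall_closure n (f : formula L n) :
  holds_in A (forall_closure f) <-> forall v, sat (A := A) f v.
Proof.
elim: n f => [//|n IHn] f; split=> [/IHn fP v|fP].
  by rewrite -(env_cons_eta v); exact: fP.
by apply/IHn => v a; exact: fP.
Qed.

Lemma holds_exists_closure n (f : formula L n) :
  holds_in A (exists_closure f) <-> exists v, sat (A := A) f v.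
Proof.
elim: n f => [|n IHn] f.
  have v0 : 'I_0 -> A by case.
  split=> [fP|[v fv] w]; first by exists v0.
  by rewrite (_ : w = v) //; apply/funext; case.
split=> [/IHn [v [a fav]]|[v fv]]; first by exists (env_cons a v).
by apply/IHn; exists (v \o lift ord0), (v ord0); rewrite env_cons_eta.
Qed.

End Closures.

(** Stripping the quantifier prefix turns membership in [Ucl] into a transfer of valid
    quantifier-free formulas, the form in which it is checked below. *)
Lemma UclP (L : language) (B A : algebra L) :
  Ucl B A <-> forall n (f : formula L n), qfree f ->
    (forall v, sat (A := B) f v) -> forall v, sat (A := A) f v.
Proof.
split=> [AB n f fq fB|AB s [[n [f [fq ->]]] /holds_forall_closure fB]].
  apply/holds_forall_closure/AB; split; first by exists n, f.
  exact/holds_forall_closure.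
exact/holds_forall_closure/AB.
Qed.

Lemma Ucl_Th_forall (L : language) (B A : algebra L) :
  Ucl B A <-> Th_forall B `<=` Th_forall A.
Proof.
split=> [AB s sB|BA s /BA []//]; split; [by case: sB|exact: AB].
Qed.

(** If the existential sentence failed in [B], the negation of its matrix would be a universal truth
    of [B], hence of [A], against the witness [v]. *)
Lemma Th_existsS (L : language) (B A : algebra L) :
  Ucl B A -> Th_exists A `<=` Th_exists B.
Proof.
move=> /UclP AB s [[n [f [fq ->]]] /holds_exists_closure [v fv]].
split; first by exists n, f.
apply/holds_exists_closure; apply: contrapT => /forallNP nfB.
by have := AB n (FNot f) fq nfB v; apply.
Qed.

Section Homomorphisms.
Variables (L : language) (A A' : algebra L) (h : A -> A').
Hypothesis hhom : is_hom h.

Lemma hom_eval (X : Type) (v : X -> A) (t : term L X) :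
  h (eval v t) = eval (h \o v) t.
Proof.
have [hf hc] := hhom; elim: t => //= F u IHu.
by rewrite hf; congr fun_op; apply/funext => k /=.
Qed.

Lemma embedding_sat n (f : formula L n) (v : 'I_n -> A) :
  injective h -> qfree f -> sat f (h \o v) <-> sat f v.
Proof.
move=> hinj; elim: f v => //= {n}.
- by move=> n t s v _; rewrite -!hom_eval; split=> [/hinj|->].
- by move=> n f IHf v /IHf ->.
- by move=> n f IHf g IHg v [/IHf -> /IHg ->].
- by move=> n f IHf g IHg v [/IHf -> /IHg ->].
Qed.

End Homomorphisms.

Lemma Ucl_embeds (L : language) (B A A' : algebra L) :
  embeds A A' -> Ucl B A' -> Ucl B A.
Proof.
move=> [h hhom hinj] /UclP BA'; apply/UclP => n f fq fB v.
by apply/(embedding_sat hhom _ hinj fq)/BA'.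
Qed.

Lemma isomorphic_embeds (L : language) (A A' : algebra L) :
  isomorphic A A' -> embeds A A'.
Proof. by move=> [h hhom /bij_inj hinj]; exists h. Qed.

(** * Quotients of term algebras and homomorphisms given by points *)

Section TermQuotient.
Variables (L : language) (X : Type) (TX : inhabited (term L X)).
Variable (theta : congruence (term_algebra TX)).

Let Q := quotient_algebra theta.

(** The generic point of the quotient: the equations that hold at it are exactly those in
    [theta]. *)
Definition generic (x : X) : Q := pi theta (Var x).

Lemma eval_generic (t : term L X) : eval generic t = pi theta t.
Proof.
have -> : generic = pi theta \o Var by [].
rewrite -(hom_eval (pi_is_hom theta) (@Var L X : X -> term_algebra TX)).
by congr pi; elim: t => //= F u IHu; congr App; exact/funext.
Qed.

Variables (A : algebra L) (v : X -> A).

(** The homomorphism induced by the point [v], once [theta] lies in the kernel of evaluation at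
    [v]. *)
Definition quotient_eval (c : Q) : A := eval v (repr c).

Hypothesis theta_v : forall t s, theta t s -> eval v t = eval v s.

Lemma quotient_eval_pi t : quotient_eval (pi theta t) = eval v t.
Proof. by apply/theta_v/(pi_eq (cong_equiv theta)); rewrite reprK. Qed.

Lemma quotient_eval_is_hom : is_hom quotient_eval.
Proof. by split=> *; exact: quotient_eval_pi. Qed.

Lemma quotient_eval_inj :
  (forall t s, eval v t = eval v s -> theta t s) -> injective quotient_eval.
Proof.
by move=> v_theta c d /v_theta/(pi_eq (cong_equiv theta)); rewrite !reprK.
Qed.

End TermQuotient.

(** By extensionality and proof irrelevance the two congruences are equal, so the identity
    serves. *)
Lemma quotient_isomorphic (L : language) (A : algebra L)
    (theta theta' : congruence A) :
  (forall x y, theta x y <-> theta' x y) ->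
  isomorphic (quotient_algebra theta) (quotient_algebra theta').
Proof.
move=> tt'; suff -> : theta = theta'.
  by exists id; [split|exists id].
case: theta theta' tt' => [R Re Rf] [R' Re' Rf'] /= tt'.
have eR : R = R' by apply/funext=> x; apply/funext=> y; exact/propext.
by case: _ / eR in Re' Rf' *; congr Congruence; exact: Prop_irrelevance.
Qed.

(** * Embeddings into ultrapowers *)

Section Los.
Variables (L : language) (B : algebra L) (I : Type).
Variables (D : set_system I) (UD : UltraFilter D).

Lemma ultra_setC (A : set I) : D (~` A) <-> ~ D A.
Proof.
split=> [DnA DA|]; last by case: (in_ultra_setVsetC A UD).
have /filter_ex [i []] : D (A `&` ~` A) by exact: filterI.
by [].
Qed.

Lemma eval_power (X : Type) (v : X -> power_algebra B I) (t : term L X) i :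
  eval v t i = eval (fun x => v x i) t.
Proof. by elim: t => //= F u IHu; congr fun_op; exact/funext. Qed.

(** Los's theorem for quantifier-free formulas. The ultrafilter dichotomy enters at negation and
    disjunction. *)
Lemma qfree_Los n (f : formula L n) (v : 'I_n -> power_algebra B I) :
  qfree f ->
  sat (A := ultrapower B UD) f (pi (ultra_congruence B UD) \o v) <->
  D [set i | sat f (fun k => v k i)].
Proof.
elim: f v => //= {n}.
- move=> n t s v _; rewrite -!(hom_eval (pi_is_hom (ultra_congruence B UD))).
  rewrite (pi_eq (cong_equiv (ultra_congruence B UD))) /= /ultra_rel.
  by under eq_set do rewrite !eval_power.
- by move=> n f IHf v /IHf ->; rewrite -ultra_setC.
- move=> n f IHf g IHg v [/IHf -> /IHg ->]; split=> [[]|Dfg].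
    exact: filterI.
  by split; apply: filterS Dfg => i [].
- move=> n f IHf g IHg v [/IHf -> /IHg ->]; split=> [|Dfg].
    by case; apply: filterS => i; [left|right].
  case: (in_ultra_setVsetC [set i | sat f (fun k => v k i)] UD) => [|Dnf].
    by left.
  by right; apply: filterS2 Dfg Dnf => i [].
Qed.

Lemma Ucl_ultrapower : Ucl B (ultrapower B UD).
Proof.
apply/UclP => n f fq fB v.
have -> : v = pi (ultra_congruence B UD) \o (fun k => repr (v k)).
  by apply/funext => k /=; rewrite reprK.
by apply/qfree_Los => //; apply: filterS filterT => i _; exact: fB.
Qed.

End Los.

Section TermQuotientUltrapower.
Variables (L : language) (B : algebra L) (n : nat).
Variables (TX : inhabited (term L 'I_n)) (theta : congruence (term_algebra TX)).

Let C := quotient_algebra theta.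

(* The index set is [B^n]; the ultrafilter contains the solution set of every
   quantifier-free formula true at the generic point, and the coordinate
   functions on [B^n] are the image of the generic point. *)
Lemma embeds_ultrapower :
  Th_exists C `<=` Th_exists B ->
  exists (I : Type) (D : set_system I) (UD : UltraFilter D),
    embeds C (ultrapower B UD).
Proof.
move=> CB.
pose gen : 'I_n -> C := generic theta.
pose true_at_gen := [set f : formula L n | qfree f /\ sat f gen].
pose D0 : set_system ('I_n -> B) :=
  filter_from true_at_gen (fun f => [set b | sat f b]).
have D0_proper : ProperFilter D0.
  apply: filter_from_proper => [|f [fq fgen]]; last first.
    (* The generic point witnesses the existential closure of [f] in [C], so it is true in [B], and
       a witness there is a point of the generating set. *)
    have [_ /holds_exists_closure [b fb]] : Th_exists B (exists_closure f).
      by apply: CB; split; [exists n, f|apply/holds_exists_closure; exists gen].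
    by exists b.
  apply: filter_from_filter => [|f g [fq fgen] [gq ggen]].
    (* A trivial equation makes the generating family non-empty; [TX] supplies the term. *)
    by have [t] := TX; exists (FEq t t).
  by exists (FAnd f g).
have [D [UD D0D]] := ultraFilterLemma D0_proper.
have DP f : qfree f -> sat f gen -> D [set b : 'I_n -> B | sat f b].
  by move=> fq fgen; apply: D0D; exists f.
pose coord (k : 'I_n) : power_algebra B ('I_n -> B) := fun b => b k.
pose v : 'I_n -> ultrapower B UD := pi (ultra_congruence B UD) \o coord.
have v_eq t s : eval v t = eval v s <->
    D [set b : 'I_n -> B | eval b t = eval b s].
  exact: (qfree_Los UD (f := FEq t s) coord I).
exists ('I_n -> B), D, UD, (quotient_eval v).
  apply: quotient_eval_is_hom => t s ts; apply/v_eq/(DP (FEq t s)) => //=.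
  by rewrite !eval_generic; exact/(pi_eq (cong_equiv theta)).
apply: quotient_eval_inj => t s /v_eq Dts; apply: contrapT => nts.
(* The negated equation is also quantifier-free and true at the generic point, so [D] contains the
   complement too. *)
suff /ultra_setC : D [set b : 'I_n -> B | ~ eval b t = eval b s] by apply.
apply: (DP (FNot (FEq t s))) => //=; rewrite !eval_generic.
by move/(pi_eq (cong_equiv theta)).
Qed.

End TermQuotientUltrapower.

(** * Irreducible sets *)

Lemma finite_set_range (T : Type) (A : set T) :
  finite_set A -> exists m (e : 'I_m -> T), A = range e.
Proof.
move=> /(@finite_seqP {classic T}) [s ->].
exists (size s), (tnth (in_tuple s)); apply/seteqP.
split=> [x /= xs|x /= [i _ <-]].
  by have /tnthP [i ->] : x \in in_tuple s by []; exists i.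
exact: (mem_tnth i (in_tuple s)).
Qed.

Section Irreducible.
Variables (L : language) (B : algebra L) (n : nat) (Y : set ('I_n -> B)).
Hypotheses (Yalg : algebraic Y) (Yirr : irreducible Y).

(** Otherwise [Y] would be the union of its subsets cut out by the single equations [e i], each
    algebraic, and proper because [e i] is outside the radical. *)
Lemma irreducible_point m (e : 'I_m -> equation L n) :
  (forall i, ~ Rad Y (e i)) -> exists2 v, Y v & forall i, ~ eq_holds v (e i).
Proof.
move=> eY; apply: contrapT => nv; have [_ []] := Yirr.
exists m, (fun i => Y `&` [set v | eq_holds v (e i)]); split=> [i|].
  split.
    have [S ->] := Yalg; exists (S `|` [set e i]); apply/seteqP; split=> v.
      by move=> [Sv ev] e' [/Sv//|->].
    by move=> Sv; split=> [e' Se'|]; apply: Sv; [left|right].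
  split=> [v []//|Ye]; apply: (eY i) => v Yv.
  by have [] := Ye v Yv.
apply/seteqP; split=> [v Yv|v [i _ []]//].
apply: contrapT => nZ; apply: nv; exists v => // i ei.
by apply: nZ; exists i.
Qed.

Lemma irreducible_discriminated (TX : inhabited (term L 'I_n)) :
  discriminated (coordinate_algebra TX Y) B.
Proof.
move=> W Wfin; set C := coordinate_algebra TX Y.
(* Each pair of distinct elements of [W] gives, through representatives, one equation outside the
   radical; a single point of [Y] violates them all. *)
have Wfin2 : finite_set [set p : C * C | (W p.1 /\ W p.2) /\ p.1 <> p.2].
  by apply: sub_finite_set (finite_setX Wfin Wfin) => p [].
have [m [p pE]] := finite_set_range Wfin2.
have [i|v Yv vP] :=
  @irreducible_point m (fun i => (repr (p i).1, repr (p i).2)).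
  move=> /(pi_eq (Rad_rel_equiv TX Y)); rewrite !reprK => pi12.
  have : range p (p i) by exists i.
  by rewrite -pE => -[].
exists (quotient_eval v).
  by apply: quotient_eval_is_hom => t s; exact.
move=> c d /set_mem Wc /set_mem Wd; apply: contraPP => cd.
have : range p (c, d) by rewrite -pE.
by move=> [i _ pi]; have := vP i; rewrite pi.
Qed.

End Irreducible.

(** * Universal theories of limit algebras *)

Section LimitUcl.
Variables (L : language) (S : direct_system L).

Lemma diagram_inj (A : algebra L) i (w : ds_var i -> A) :
  (forall l, ds_phi S i l -> lit_holds (atom_holds w) l) -> injective w.
Proof.
move=> wP x y wxy; apply: contrapT => xy.
by have [_ /(_ _ _ xy) /wP /= nwxy _ _] := ds_phi_diagram i; exact: nwxy.
Qed.

(** If distinct variables were identified at a stage [k], their inequality would become [~ z = z]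
    among the conjuncts there, against consistency. *)
Lemma limit_in_inj i : injective (@limit_in L S i).
Proof.
move=> x y /(pi_eq (limit_rel_equiv S)) [k [/= ik _ exy]].
apply: contrapT => xy.
have [_ /(_ _ _ xy) /(ds_phi_le ik) /= nxy _ _] := ds_phi_diagram i.
have [A [w wP]] := ds_phi_consistent k.
by apply: (wP _ nxy); rewrite /= exy.
Qed.

Variable B : algebra L.

Definition realizes i (w : ds_var i -> B) : Prop :=
  forall l, ds_phi S i l -> lit_holds (atom_holds w) l.

(* A term mentions finitely many symbols, so from some index on the diagrams
   determine its value. *)
Lemma limit_term i (X : Type) (x : X -> ds_var i) (t : term L X) :
  exists2 j, ds_le i j & forall k, ds_le j k -> exists2 y : ds_var k,
    eval (A := limit_algebra S) (fun a => limit_in (x a)) t = limit_in y &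
    forall w : ds_var k -> B, realizes w ->
      eval (fun a => w (ds_gamma S i k (x a))) t = w y.
Proof.
elim: t => [a|F u IHu|c].
- exists i; first exact: ds_le_refl.
  by move=> k ik; exists (ds_gamma S i k (x a)); rewrite ?limit_in_gamma.
- have /boolp.choice [f fP] : forall a, exists j, ds_le i j /\
      forall k, ds_le j k -> exists2 y : ds_var k,
      eval (A := limit_algebra S) (fun a => limit_in (x a)) (u a) = limit_in y &
      forall w : ds_var k -> B, realizes w ->
        eval (fun a => w (ds_gamma S i k (x a))) (u a) = w y.
    by move=> a; have [j ij jP] := IHu a; exists j.
  have [j0 fj0] := directed_family f.
  have [j [ij j0j]] := ds_directed i j0.
  have /boolp.choice [y yP] : forall a, exists y : ds_var j,
      eval (A := limit_algebra S) (fun a => limit_in (x a)) (u a) = limit_in y.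
    move=> a; have [_ /(_ j)] := fP a.
    by case=> [|y yE _]; [exact: ds_le_trans (fj0 a) j0j|exists y].
  have [j' [y0 [jj' Fy]]] := ds_fun y.
  exists j'; first exact: ds_le_trans ij jj'.
  move=> k j'k; have jk := ds_le_trans jj' j'k.
  have {Fy} /= Fy := ds_phi_le j'k Fy.
  exists (ds_gamma S j' k y0) => [|w wP] /=.
    rewrite -(limit_funE Fy) /=; congr (fun_op (limit_algebra S) F _).
    by apply/funext => a /=; rewrite yP !limit_in_gamma.
  rewrite -(wP _ Fy) /=; congr fun_op; apply/funext => a /=.
  have [_ /(_ k)] := fP a.
  case=> [|z zE zP]; first exact: ds_le_trans (fj0 a) (ds_le_trans j0j jk).
  (* The variable [z] naming the argument at stage [k] is the transported [y a], since both have the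
     same image in the limit. *)
  rewrite zP //; congr w; apply: limit_in_inj.
  by rewrite -zE yP !limit_in_gamma.
- have [j [z cz]] := ds_cst S c; have [m [im jm]] := ds_directed i j.
  exists m => // k mk; have jk := ds_le_trans jm mk.
  have cz' := ds_phi_le jk cz.
  by exists (ds_gamma S j k z); [exact: limit_cstE|move=> w /(_ _ cz')].
Qed.

(** For an equation, both sides are named by variables of a late stage; the limit and any
    realization in [B] each hold these equal only if they are the same variable. Upper bounds of
    stages handle the connectives. *)
Lemma limit_formula i n (x : 'I_n -> ds_var i) (f : formula L n) :
  qfree f ->
  exists2 j, ds_le i j & forall k, ds_le j k -> forall w : ds_var k -> B,
    realizes w ->
    sat (A := limit_algebra S) f (fun a => limit_in (x a)) <->
    sat f (fun a => w (ds_gamma S i k (x a))).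
Proof.
elim: f x => //= {n}.
- move=> n t s x _.
  have [jt ijt tP] := limit_term x t; have [js ijs sP] := limit_term x s.
  have [j [jtj jsj]] := ds_directed jt js; exists j.
    exact: ds_le_trans ijt jtj.
  move=> k jk w wP.
  have [y -> yP] := tP k (ds_le_trans jtj jk).
  have [z -> zP] := sP k (ds_le_trans jsj jk).
  rewrite yP // zP //; split=> [/limit_in_inj ->//|].
  by move=> /(diagram_inj wP) ->.
- move=> n f IHf x /(IHf x) [j ij fP]; exists j => // k jk w wP.
  by rewrite (fP k jk w wP).
- move=> n f IHf g IHg x [/(IHf x) [j ij fP] /(IHg x) [j' _ gP]].
  have [m [jm j'm]] := ds_directed j j'; exists m.
    exact: ds_le_trans ij jm.
  move=> k mk w wP.
  by rewrite (fP k (ds_le_trans jm mk) w wP) (gP k (ds_le_trans j'm mk) w wP).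
- move=> n f IHf g IHg x [/(IHf x) [j ij fP] /(IHg x) [j' _ gP]].
  have [m [jm j'm]] := ds_directed j j'; exists m.
    exact: ds_le_trans ij jm.
  move=> k mk w wP.
  by rewrite (fP k (ds_le_trans jm mk) w wP) (gP k (ds_le_trans j'm mk) w wP).
Qed.

Lemma limit_in_family n (v : 'I_n -> limit_algebra S) :
  exists i (x : 'I_n -> ds_var i), v = fun a => limit_in (x a).
Proof.
have [i vi] := directed_family (fun a => projT1 (repr (v a))).
exists i, (fun a => ds_gamma S _ i (projT2 (repr (v a)))).
apply/funext => a; rewrite limit_in_gamma // -[LHS]reprK /limit_in.
by case: (repr _).
Qed.

Lemma Ucl_limit :
  (forall i : ds_index S, satisfiable_in B (ds_phi S i)) ->
  Ucl B (limit_algebra S).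
Proof.
move=> SB; apply/UclP => n f fq fB v.
have [i [x ->]] := limit_in_family v.
(* At this stage [f] has the same truth value in the limit as at a realization of the diagram in
   [B], where it is valid. *)
have [j _ /(_ j (ds_le_refl j)) jP] := limit_formula x fq.
by have [w /jP ->] := SB j.
Qed.

End LimitUcl.

Lemma Ucl_limit_algebra_over (L : language) (B C : algebra L) :
  limit_algebra_over B C -> Ucl B C.
Proof.
move=> [S [SB /isomorphic_embeds CS]].
exact: Ucl_embeds CS (Ucl_limit SB).
Qed.

Lemma finite_setUP (T : Type) (A B : set T) :
  finite_set A -> finite_set B -> finite_set (A `|` B).
Proof. by rewrite finite_setU. Qed.

(** * The direct system of the finite subsets of an algebra *)

Section FiniteSubsets.
Variables (L : language) (C : algebra L) (c0 : C).

(** Every subset contains the base point [c0], so that no stage has an empty set of variables. *)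
Definition fs_index : Type :=
  {p : finite_sublanguage L * {fset {classic C}} | c0 \in p.2}.

Definition fs_lang (i : fs_index) : finite_sublanguage L := (val i).1.

Definition fs_var (i : fs_index) : finType := fset_sub_type (val i).2.

Definition fs_val (i : fs_index) (x : fs_var i) : C := \val x.

Definition fs_le (i j : fs_index) : Prop :=
  sublanguage_le (fs_lang i) (fs_lang j) /\ ((val i).2 `<=` (val j).2)%fset.

(** The inclusion when [fs_le i j]; an element missing from the target goes to the default [c0]. *)
Definition fs_gamma (i j : fs_index) (x : fs_var i) : fs_var j :=
  insubd ([` valP j]%fset : fs_var j) (\val x).

(** The diagram in [C] of the finite subset, each element serving as the variable that names it. *)
Definition fs_phi (i : fs_index) : conjunction L (fs_var i) :=
  [set l | atom_in (fs_lang i) (lit_atom l) /\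
           lit_holds (atom_holds (@fs_val i)) l].

Lemma fs_val_inj i : injective (@fs_val i).
Proof. exact: val_inj. Qed.

Lemma fs_gamma_val i j x :
  fs_le i j -> fs_val (fs_gamma j x) = fs_val (i := i) x.
Proof.
move=> [_ /fsubsetP ij]; rewrite /fs_val /fs_gamma val_insubd ifT //.
exact: ij (valP x).
Qed.

Lemma finite_sublanguage_eq (L0 L1 : finite_sublanguage L) :
  sublanguage_le L0 L1 -> sublanguage_le L1 L0 -> L0 = L1.
Proof.
case: L0 L1 => [F c Ffin cfin] [F' c' Ffin' cfin'] [/= FF' cc'] [/= F'F c'c].
have eF : F = F' by apply/seteqP.
have ec : c = c' by apply/seteqP.
case: _ / eF in Ffin' FF' F'F *; case: _ / ec in cfin' cc' c'c *.
by congr FiniteSublanguage; exact: Prop_irrelevance.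
Qed.

Lemma fs_le_refl i : fs_le i i.
Proof. by split=> //; split. Qed.

Lemma fs_le_anti i j : fs_le i j -> fs_le j i -> i = j.
Proof.
move=> [lij ij] [lji ji]; apply: val_inj.
rewrite /fs_lang in lij lji.
case: (val i) (val j) ij ji lij lji => [Li Xi] [Lj Xj] /= ij ji lij lji.
congr pair; first exact: finite_sublanguage_eq lij lji.
by apply/eqP; rewrite eqEfsubset ij.
Qed.

Lemma fs_le_trans i j k : fs_le i j -> fs_le j k -> fs_le i k.
Proof.
move=> [[fij cij] ij] [[fjk cjk] jk].
split; last exact: fsubset_trans ij jk.
by split; [exact: subset_trans fij fjk|exact: subset_trans cij cjk].
Qed.

Definition sublanguageU (L0 L1 : finite_sublanguage L) :
    finite_sublanguage L :=
  FiniteSublanguage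
    (finite_setUP (sub_fsym_finite L0) (sub_fsym_finite L1))
    (finite_setUP (sub_csym_finite L0) (sub_csym_finite L1)).

Definition sublanguage0 : finite_sublanguage L :=
  FiniteSublanguage (finite_set0 (fsym L)) (finite_set0 (csym L)).

Definition sublanguage_fun (F : fsym L) : finite_sublanguage L :=
  FiniteSublanguage (finite_set1 F) (finite_set0 (csym L)).

Definition sublanguage_cst (c : csym L) : finite_sublanguage L :=
  FiniteSublanguage (finite_set0 (fsym L)) (finite_set1 c).

Definition fs_make (L0 : finite_sublanguage L) (X : {fset {classic C}}) :
    fs_index :=
  let a : {classic C} := c0 in exist _ (L0, a |` X)%fset (fset1U1 a X).

Lemma mem_fs_make L0 (c : {classic C}) :
  c \in (val (fs_make L0 [fset c]%fset)).2.
Proof. by rewrite !inE eqxx orbT. Qed.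

Lemma fs_directed i j : exists k, fs_le i k /\ fs_le j k.
Proof.
exists (fs_make (sublanguageU (fs_lang i) (fs_lang j))
  ((val i).2 `|` (val j).2)%fset).
split; split; try by split=> ? ?; (left + right).
  exact: fsubset_trans (fsubsetUl _ _) (fsubsetUr _ _).
exact: fsubset_trans (fsubsetUr _ _) (fsubsetUr _ _).
Qed.

(** Cofinality: it provides the later stages in which constants and values of operations have
    names. *)
Lemma fs_extend i (L0 : finite_sublanguage L) (c : C) :
  exists j (y : fs_var j),
    [/\ fs_le i j, sublanguage_le L0 (fs_lang j) & fs_val y = c].
Proof.
have [j [ij [kj kjX]]] :=
  fs_directed i (fs_make L0 [fset (c : {classic C})]%fset).
by exists j, [` fsubsetP kjX _ (mem_fs_make L0 c)]%fset; split.
Qed.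

Lemma fs_phi_diagram i : diagram_formula (fs_lang i) (@fs_phi i).
Proof.
split=> [l []//|y y' yy'|F y y0 Fi|c y ci].
- by split=> // /fs_val_inj.
- by have [e|ne] := pselect (fun_op C F (@fs_val i \o y) = fs_val y0);
    [left|right].
- by have [e|ne] := pselect (cst_op C c = fs_val y); [left|right].
Qed.

Lemma fs_phi_consistent i : consistent (@fs_phi i).
Proof. by exists C, (@fs_val i) => l []. Qed.

Lemma fs_phi_le i j l :
  fs_le i j -> @fs_phi i l -> @fs_phi j (lit_map (atom_map (@fs_gamma i j)) l).
Proof.
move=> ij [li hl]; have [[Fij cij] _] := ij; split.
  by case: l li {hl} => -[F y y0|c y|y y'] //=; (exact: Fij || exact: cij).
(* Transition maps do not change the element named, so atoms keep their truth value in [C]. *)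
have atomE a : atom_holds (@fs_val j) (atom_map (@fs_gamma i j) a) <->
    atom_holds (@fs_val i) a.
  case: a => [F y y0|c y|y y'] /=; rewrite !fs_gamma_val //.
  suff -> : @fs_val j \o (@fs_gamma i j \o y) = @fs_val i \o y by [].
  by apply/funext => k /=; exact: fs_gamma_val.
by case: l hl {li} => a /= /atomE.
Qed.

Lemma fs_var_gt0 i : 0 < #|fs_var i|.
Proof. by apply/card_gt0P; exists [` valP i]%fset. Qed.

Lemma fs_gamma_id i x : @fs_gamma i i x = x.
Proof. by apply: fs_val_inj; rewrite fs_gamma_val //; exact: fs_le_refl. Qed.

Lemma fs_gamma_comp i j k x : fs_le i j -> fs_le j k ->
  fs_gamma k (@fs_gamma i j x) = fs_gamma k x.
Proof.
move=> ij jk; apply: fs_val_inj.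
by rewrite !fs_gamma_val //; exact: fs_le_trans ij jk.
Qed.

Lemma fs_cst c : exists i (x : fs_var i), fs_phi (Pos (DCst c x)).
Proof.
have [i [x [_ [_ ci] xE]]] :=
  fs_extend (fs_make sublanguage0 fset0) (sublanguage_cst c) (cst_op C c).
by exists i, x; split; [exact: ci|rewrite /= xE].
Qed.

Lemma fs_fun F i (y : 'I_(arity F) -> fs_var i) :
  exists j (y0 : fs_var j), fs_le i j /\
    fs_phi (Pos (DFun F (fun k => fs_gamma j (y k)) y0)).
Proof.
have [j [y0 [ij [Fj _] y0E]]] :=
  fs_extend i (sublanguage_fun F) (fun_op C F (fun k => fs_val (y k))).
exists j, y0; split=> //; split; first exact: Fj.
rewrite /= y0E; congr fun_op; apply/funext => k /=; exact: fs_gamma_val.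
Qed.

Definition fs_system : direct_system L :=
  DirectSystem fs_le_refl fs_le_anti fs_le_trans
    (inhabits (fs_make sublanguage0 fset0)) fs_directed fs_var_gt0
    fs_phi_diagram fs_phi_consistent
    fs_gamma_id fs_gamma_comp (fun i j => @proj1 _ _) fs_phi_le fs_cst fs_fun.

Definition fs_to_limit (c : C) : limit_algebra fs_system :=
  limit_in (S := fs_system) ([` mem_fs_make sublanguage0 c]%fset : fs_var _).

Lemma limit_in_fs i (x : fs_var i) :
  limit_in (S := fs_system) x = fs_to_limit (fs_val x).
Proof.
pose j := fs_make sublanguage0 [fset (fs_val x : {classic C})]%fset.
have [k [ik jk]] := fs_directed i j.
apply/(pi_eq (limit_rel_equiv fs_system)); exists k; split; [done|done|].
by apply: fs_val_inj; rewrite !fs_gamma_val.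
Qed.

Lemma isomorphic_fs_system : isomorphic C (limit_algebra fs_system).
Proof.
exists fs_to_limit.
  split=> [F u|c].
    (* The finitely many arguments of [F] are brought to a common stage. *)
    have [i ui] : exists i, forall k, exists x : fs_var i, fs_val x = u k.
      have /boolp.choice [f fP] k :
          exists i, exists x : fs_var i, fs_val x = u k.
        have [i [x [_ _ xE]]] :=
          fs_extend (fs_make sublanguage0 fset0) sublanguage0 (u k).
        by exists i, x.
      have [i fi] := directed_family (S := fs_system) f.
      exists i => k; have [x <-] := fP k.
      by exists (fs_gamma i x); exact/fs_gamma_val/fi.
    have /boolp.choice [y yE] := ui.
    have [j [y0 [ij Fy]]] := fs_fun y.
    have := limit_funE (S := fs_system) Fy; rewrite limit_in_fs.
    have [_ /= <-] := Fy.
    have -> : (fun k => limit_in (S := fs_system) (fs_gamma j (y k))) =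
        fs_to_limit \o u.
      by apply/funext => k; rewrite limit_in_fs fs_gamma_val // yE.
    move=> ->; congr fs_to_limit; congr fun_op.
    by apply/funext => k /=; rewrite fs_gamma_val.
  have [i [x cx]] := fs_cst c.
  by rewrite (limit_cstE (S := fs_system) cx) limit_in_fs; have [_ /= <-] := cx.
rewrite -setTT_bijective; split=> //.
  move=> c d _ _.
  have [i [x [_ _ <-]]] :=
    fs_extend (fs_make sublanguage0 fset0) sublanguage0 c.
  have [j [y [ij _ <-]]] := fs_extend i sublanguage0 d.
  rewrite -(fs_gamma_val x ij) -!limit_in_fs.
  by move=> /limit_in_inj ->.
move=> w _; rewrite -(reprK w); case: (repr w) => i x.
by exists (fs_val (i := i) x) => //; rewrite -limit_in_fs.
Qed.

Variable B : algebra L.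

(* Injectivity on [fs_var i] alone does not suffice: to preserve the conjuncts
   [~ F(y) = y0] and [~ c = y0], the homomorphism must also separate the values
   of the operations and constants of [fs_lang i]. *)
Lemma fs_satisfiable i : discriminated C B -> satisfiable_in B (@fs_phi i).
Proof.
move=> CB.
pose W : set C := range (@fs_val i) `|`
  (\bigcup_(F in sub_fsym (fs_lang i))
     range (fun y : {ffun 'I_(arity F) -> fs_var i} =>
       fun_op C F (@fs_val i \o y)) `|`
   cst_op C @` sub_csym (fs_lang i)).
have Wfin : finite_set W.
  apply: finite_setUP; first exact/finite_image/finite_finset.
  apply: finite_setUP.
    apply: bigcup_finite => [|F _]; first exact: sub_fsym_finite.
    (* Argument tuples were taken in the finite type [{ffun 'I_(arity F) -> fs_var i}], so the
       values of [F] form a finite set. *)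
    exact/finite_image/finite_finset.
  exact/finite_image/sub_csym_finite.
have [h [hfun hcst] hinj] := CB W Wfin.
have WX x : W (fs_val (i := i) x) by left; exists x.
have WI a b : W a -> W b -> h a = h b -> a = b.
  by move=> Wa Wb; apply: hinj; exact/mem_set.
exists (h \o @fs_val i) => l [].
have atomE a : atom_in (fs_lang i) a ->
    atom_holds (h \o @fs_val i) a <-> atom_holds (@fs_val i) a.
  case: a => [F y y0|c y|y y'] /= la.
  - rewrite -compA -hfun; split=> [|->//]; apply: WI => //; right; left.
    exists F => //; exists (finfun y) => //.
    by congr fun_op; apply/funext => k /=; rewrite ffunE.
  - by rewrite -hcst; split=> [|->//]; apply: WI => //; right; right; exists c.
  - by split=> [|->//]; apply: WI.
by case: l => a la; rewrite /= atomE.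
Qed.

End FiniteSubsets.

Lemma discriminated_limit (L : language) (B C : algebra L) :
  discriminated C B -> limit_algebra_over B C.
Proof.
move=> CB; have [c0] := carrier_inh C; exists (fs_system c0).
split; last exact: isomorphic_fs_system.
by move=> i; exact: fs_satisfiable.
Qed.

(** * Complete atomic types *)

Section AtomicTypes.
Variables (L : language) (T : theory L).

Definition type_of (A : algebra L) n (v : 'I_n -> A) :
  set (literal (equation L n)) := [set l | lit_holds (eq_holds v) l].

(** For each equation the type contains it or its negation, so a literal added from outside would
    contradict one already present. *)
Lemma type_of_complete (A : algebra L) n (v : 'I_n -> A) :
  models A T -> complete_atomic_type T (type_of v).
Proof.
move=> AT; split=> [|q [A' A'T [v' qv']] vq]; first by exists A => //; exists v.
apply/seteqP; split=> // l ql; apply: contrapT => nl.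
case: l ql nl => e /qv' /= ev' nev.
  by apply: (qv' (Neg e)) => //; exact: vq.
by apply: ev'; apply: (qv' (Pos e)); apply: vq; exact: contrapT nev.
Qed.

Lemma models_defined_by_type n (TX : inhabited (term L 'I_n))
    (theta : congruence (term_algebra TX)) :
  models (quotient_algebra theta) T ->
  defined_by_complete_atomic_type T (quotient_algebra theta).
Proof.
move=> CT; exists n, TX, (type_of (generic theta)), (type_of_complete _ CT).
apply: quotient_isomorphic => t s.
rewrite /= /type_rel /type_of /= /eq_holds /= !eval_generic.
by rewrite (pi_eq (cong_equiv theta)).
Qed.

End AtomicTypes.

(** The type is that of a point [v] in a model [A] of the universal theory, and evaluation at [v]
    embeds the type algebra into [A]. *)
Lemma Ucl_defined_by_type (L : language) (B C : algebra L) :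
  defined_by_complete_atomic_type (Th_forall B) C -> Ucl B C.
Proof.
move=> [n [TX [p [pT /isomorphic_embeds CT]]]]; apply: Ucl_embeds CT _.
have [A [v [AB pE]]] := complete_atomic_typeE pT; apply: Ucl_embeds AB.
exists (quotient_eval v).
  by apply: quotient_eval_is_hom => t s; rewrite /= /type_rel pE.
by apply: quotient_eval_inj => t s; rewrite /= /type_rel pE.
Qed.

Theorem theorem3p11 (L : language) (B : algebra L) :
  (weakly_u_omega_compact B ->
   forall (n : nat) (TX : inhabited (term L 'I_n)) (Y : set ('I_n -> B)),
     algebraic Y -> Y !=set0 ->
     [<-> Th_forall B `<=` Th_forall (coordinate_algebra TX Y);
          Th_exists (coordinate_algebra TX Y) `<=` Th_exists B;
          exists (I : Type) (D : set_system I) (UD : UltraFilter D),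
            embeds (coordinate_algebra TX Y) (ultrapower B UD);
          discriminated (coordinate_algebra TX Y) B;
          limit_algebra_over B (coordinate_algebra TX Y);
          defined_by_complete_atomic_type (Th_forall B)
            (coordinate_algebra TX Y);
          irreducible Y])
  /\
  ((forall (n : nat) (TX : inhabited (term L 'I_n)) (Y : set ('I_n -> B)),
     algebraic Y -> Y !=set0 ->
     [<-> Th_forall B `<=` Th_forall (coordinate_algebra TX Y);
          Th_exists (coordinate_algebra TX Y) `<=` Th_exists B;
          exists (I : Type) (D : set_system I) (UD : UltraFilter D),
            embeds (coordinate_algebra TX Y) (ultrapower B UD);
          discriminated (coordinate_algebra TX Y) B;
          limit_algebra_over B (coordinate_algebra TX Y);
          defined_by_complete_atomic_type (Th_forall B)
            (coordinate_algebra TX Y);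
          irreducible Y]) ->
   weakly_u_omega_compact B).
Proof.
split=> [wuc n TX Y Yalg Y0|equiv n TX Y Yalg Y0 /Ucl_Th_forall].
  set C := coordinate_algebra TX Y.
  have irr_discr : irreducible Y -> discriminated C B.
    by move=> Yirr; exact: irreducible_discriminated.
  have Ucl_irr : Ucl B C -> irreducible Y by exact: wuc.
  tfae.
  - by move=> /Ucl_Th_forall; exact: Th_existsS.
  - exact: embeds_ultrapower.
  (* Weak compactness enters here: [C] is in [Ucl B] as a subalgebra of an ultrapower, so [Y] is
     irreducible and [C] is discriminated. *)
  - move=> [I [D [UD CBD]]]; apply/irr_discr/Ucl_irr.
    apply: (Ucl_embeds CBD); exact: Ucl_ultrapower.
  - exact: discriminated_limit.
  - by move=> /Ucl_limit_algebra_over; exact: models_defined_by_type.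
  (* The second use of weak compactness, through [Ucl_irr]. *)
  - by move=> /Ucl_defined_by_type.
  - move=> /irr_discr /discriminated_limit /Ucl_limit_algebra_over.
    by move=> /Ucl_Th_forall.
(* Counting from zero, [0] and [6] are conditions 1) and 7), whose implication is weak
   compactness. *)
exact: (all_iffLR (equiv n TX Y Yalg Y0) 0 6).
Qed.
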